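(* Let $E=PP([0,\infty))$ be the Archimedean Riesz space of piecewise polynomials on $[0,\infty)$ and let $p\in E$ be the function $p(x)=x$. Then $E_p\bar{\otimes}E_p$ is not an ideal in $E\bar{\otimes}E$.
   Context: A Riesz space is a real vector lattice; $E^+$ denotes its positive cone. A function $q:[0,\infty)\to\mathbb{R}$ is a piecewise polynomial if there are $n\in\mathbb{N}$ and $0=t_1<t_2<\cdots<t_n$ such that $q$ is a polynomial function on $[t_n,\infty)$ and on $[t_i,t_{i+1}]$ for each $i=1,\dots,n-1$. $PP([0,\infty))$ is the set of all these, with pointwise operations and order. Principal ideal: for $f\in E$, $E_f=\{g\in E: |g|\le\lambda|f| \text{ for some } \lambda\in\mathbb{R}^+\}$. An ideal of a Riesz space $G$ is a linear subspace $A$ such that $|g|\le|a|$, $a\in A$, $g\in G$ imply $g\in A$. Fremlin tensor product: for Archimedean Riesz spaces $E,F,G$, a Riesz bimorphism is a bilinear map $T:E\times F\to G$ such that $z\mapsto T(z,y)$, $E\to G$, and $z\mapsto T(x,z)$, $F\to G$, are Riesz homomorphisms for all $x\in E^+$, $y\in F^+$. The Archimedean Riesz space tensor product (Fremlin tensor product) $E\bar{\otimes}F$ is the Archimedean Riesz space, unique up to Riesz isomorphism, equipped with a Riesz bimorphism $\otimes:E\times F\to E\bar{\otimes}F$ such that for every Archimedean Riesz space $H$ and Riesz bimorphism $\psi:E\times F\to H$ there is a unique Riesz homomorphism $T:E\bar{\otimes}F\to H$ with $T\circ\otimes=\psi$. If moreover $\psi(x,y)>0$ whenever $x>0$ and $y>0$,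 then $E\bar{\otimes}F$ may be identified with the Riesz subspace of $H$ generated by $\psi[E\times F]$. In particular, for Riesz subspaces $E_0\subseteq E$, $F_0\subseteq F$, $E_0\bar{\otimes}F_0$ is identified with the Riesz subspace of $E\bar{\otimes}F$ generated by $\{e\otimes f: e\in E_0, f\in F_0\}$. *)

(* Defs.v *)
From HB Require Import structures.
From mathcomp Require Import all_boot all_order all_algebra generic_quotient.
From mathcomp Require Import interval_inference polyrcf.
From mathcomp Require Import all_classical all_reals.

Set Implicit Arguments.
Unset Strict Implicit.
Unset Printing Implicit Defensive.

Import Order.TTheory GRing.Theory Num.Theory.
Local Open Scope classical_set_scope.
Local Open Scope ring_scope.

(* The lattice operations are fields of the mixin rather than an
   [Order.Lattice] superclass: mathcomp's numeric types are both lattices and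
   Z-modules without a structure joining the two, so Hierarchy Builder rejects
   a further structure that inherits from both. *)
HB.mixin Record Lmodule_POrder_isRiesz (R : realType) E
    of GRing.Lmodule R E & Order.POrder ring_display E := {
  rjoin : E -> E -> E ;
  rmeet : E -> E -> E ;
  rjoin_le : forall x y z : E, (rjoin x y <= z) = (x <= z) && (y <= z) ;
  le_rmeet : forall x y z : E, (z <= rmeet x y) = (z <= x) && (z <= y) ;
  riesz_leD2r : forall x y z : E, x <= y -> x + z <= y + z ;
  riesz_scale_ge0 : forall (a : R) (x : E), 0 <= a -> 0 <= x -> 0 <= a *: x
}.

#[short(type="rieszType")]
HB.structure Definition Riesz (R : realType) :=
  { E of GRing.Lmodule R E & Order.POrder ring_display E &
         Lmodule_POrder_isRiesz R E }.

HB.mixin Record Riesz_isArchimedean (R : realType) E of Riesz R E := {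
  riesz_archi : forall x y : E,
    0 <= x -> 0 <= y -> (forall n : nat, x *+ n <= y) -> x = 0
}.

#[short(type="archiRieszType")]
HB.structure Definition ArchiRiesz (R : realType) :=
  { E of Riesz R E & Riesz_isArchimedean R E }.

Section RieszTheory.
Variable R : realType.

Definition riesz_abs (E : rieszType R) (x : E) : E := rjoin x (- x).

Definition linear_subspace (E : lmodType R) (A : set E) : Prop :=
  A 0 /\ forall (a : R) (x y : E), A x -> A y -> A (a *: x + y).

Definition riesz_subspace (E : rieszType R) (A : set E) : Prop :=
  [/\ linear_subspace A,
      forall x y : E, A x -> A y -> A (rjoin x y) &
      forall x y : E, A x -> A y -> A (rmeet x y)].

Definition riesz_span (E : rieszType R) (B : set E) : set E :=
  \bigcap_(A in [set A : set E | riesz_subspace A /\ B `<=` A]) A.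

Definition riesz_ideal (E : rieszType R) (A : set E) : Prop :=
  linear_subspace A /\
  forall g a : E, A a -> riesz_abs g <= riesz_abs a -> A g.

Definition principal_ideal (E : rieszType R) (f : E) : set E :=
  [set g | exists2 lambda : R, 0 <= lambda &
                               riesz_abs g <= lambda *: riesz_abs f].

Definition riesz_hom (E F : rieszType R) (f : E -> F) : Prop :=
  [/\ linear f, {morph f : x y / rjoin x y} & {morph f : x y / rmeet x y}].

Definition riesz_bimorphism (E F G : rieszType R) (T : E -> F -> G) : Prop :=
  [/\ forall y : F, linear (T^~ y),
      forall x : E, linear (T x),
      forall y : F, 0 <= y -> riesz_hom (T^~ y) &
      forall x : E, 0 <= x -> riesz_hom (T x)].

Definition fremlin_tensor (E F G : archiRieszType R) (tensor : E -> F -> G) :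
    Prop :=
  riesz_bimorphism tensor /\
  forall (H : archiRieszType R) (psi : E -> F -> H), riesz_bimorphism psi ->
    exists! T : G -> H,
      riesz_hom T /\ forall (x : E) (y : F), T (tensor x y) = psi x y.

(* For Riesz subspaces E0 of E and F0 of F, the copy of the tensor product of
   E0 and F0 inside that of E and F: the Riesz subspace generated by the
   elementary tensors. *)
Definition fremlin_subtensor (E F G : archiRieszType R) (tensor : E -> F -> G)
    (E0 : set E) (F0 : set F) : set G :=
  riesz_span [set tensor x y | x in E0 & y in F0].

End RieszTheory.

(* Existence of the tensor product, for arbitrary E and F: formal Riesz space
   expressions in elementary tensors, two of them identified when they take the
   same value under every Riesz bimorphism into an Archimedean Riesz space. *)
Section FremlinExistence.
Local Open Scope quotient_scope.
Variables (R : realType) (E F : archiRieszType R).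

Inductive tterm : Type :=
  | TGen of E & F | TZero | TAdd of tterm & tterm | TScale of R & tterm
  | TJoin of tterm & tterm | TMeet of tterm & tterm.

HB.instance Definition _ := gen_eqMixin tterm.
HB.instance Definition _ := gen_choiceMixin tterm.

Fixpoint teval (H : archiRieszType R) (psi : E -> F -> H) (t : tterm) : H :=
  match t with
  | TGen x y => psi x y
  | TZero => 0
  | TAdd s t => teval psi s + teval psi t
  | TScale a t => a *: teval psi t
  | TJoin s t => rjoin (teval psi s) (teval psi t)
  | TMeet s t => rmeet (teval psi s) (teval psi t)
  end.

Definition tle (s t : tterm) : Prop :=
  forall (H : archiRieszType R) (psi : E -> F -> H), riesz_bimorphism psi ->
    teval psi s <= teval psi t.

Definition teqv : rel tterm := fun s t => `[< tle s t /\ tle t s >].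

Lemma teqvP s t : reflect (forall (H : archiRieszType R) (psi : E -> F -> H),
  riesz_bimorphism psi -> teval psi s = teval psi t) (teqv s t).
Proof.
apply: (iffP (asboolP _)) => [[st ts] H psi b|h].
  by apply/eqP; rewrite eq_le st// ts.
by split=> H psi b; rewrite h.
Qed.

Lemma teqv_equiv : equiv_class_of teqv.
Proof.
split=> [s|s t|t s u].
- exact/teqvP.
- by apply/idP/idP => /teqvP st; apply/teqvP => H psi b; rewrite st.
- by move=> /teqvP st /teqvP tu; apply/teqvP => H psi b; rewrite st// tu.
Qed.

Canonical teqv_rel := EquivRelPack teqv_equiv.

Definition fremlin := {eq_quot teqv_rel}.
HB.instance Definition _ := Choice.on fremlin.

Definition fev (H : archiRieszType R) (psi : E -> F -> H) (x : fremlin) : H :=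
  teval psi (repr x).

Definition fpi (t : tterm) : fremlin := \pi_fremlin t.

Lemma fevE (H : archiRieszType R) (psi : E -> F -> H) t :
  riesz_bimorphism psi -> fev psi (fpi t) = teval psi t.
Proof.
move=> b; have /eqP : fpi (repr (fpi t)) = fpi t by rewrite /fpi reprK.
by rewrite /fpi eqmodE => /teqvP; apply.
Qed.

Lemma fev_ext (x y : fremlin) :
  (forall (H : archiRieszType R) (psi : E -> F -> H), riesz_bimorphism psi ->
    fev psi x = fev psi y) -> x = y.
Proof.
move=> h; rewrite -[x]reprK -[y]reprK; apply/eqP; rewrite eqmodE.
exact/teqvP.
Qed.

Definition fadd (x y : fremlin) := fpi (TAdd (repr x) (repr y)).
Definition fzero := fpi TZero.
Definition fscale a (x : fremlin) := fpi (TScale a (repr x)).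
Definition fopp := fscale (-1).
Definition fjoin (x y : fremlin) := fpi (TJoin (repr x) (repr y)).
Definition fmeet (x y : fremlin) := fpi (TMeet (repr x) (repr y)).
Definition fle (x y : fremlin) := `[< tle (repr x) (repr y) >].

Local Ltac ext := let H := fresh "H" in let psi := fresh "psi" in
  let b := fresh "b" in apply: fev_ext => H psi b;
  rewrite /fopp /fscale /fadd /fzero ?(fevE _ b)/= -?/(fev _ _) ?(fevE _ b)/= -?/(fev _ _).

Lemma faddA : associative fadd. Proof. by move=> x y z; ext; rewrite addrA. Qed.
Lemma faddC : commutative fadd. Proof. by move=> x y; ext; rewrite addrC. Qed.
Lemma fadd0 : left_id fzero fadd. Proof. by move=> x; ext; rewrite add0r. Qed.
Lemma faddN : left_inverse fzero fopp fadd.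
Proof. by move=> x; ext; rewrite scaleN1r addNr. Qed.

HB.instance Definition _ :=
  GRing.isZmodule.Build fremlin faddA faddC fadd0 faddN.

Lemma fscaleA a b x : fscale a (fscale b x) = fscale (a * b) x.
Proof. by ext; rewrite scalerA. Qed.
Lemma fscale1 : left_id 1 fscale. Proof. by move=> x; ext; rewrite scale1r. Qed.
Lemma fscaleDr : right_distributive fscale +%R.
Proof. by move=> a x y; rewrite /GRing.add/=; ext; rewrite scalerDr. Qed.
Lemma fscaleDl x : {morph fscale^~ x : a b / a + b}.
Proof. by move=> a b; rewrite [RHS]/GRing.add/=; ext; rewrite scalerDl. Qed.

HB.instance Definition _ := GRing.Zmodule_isLmodule.Build R fremlin
  fscaleA fscale1 fscaleDr fscaleDl.

Lemma fleP x y : reflect (forall (H : archiRieszType R) (psi : E -> F -> H), riesz_bimorphism psi ->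
    fev psi x <= fev psi y) (fle x y).
Proof. exact: asboolP. Qed.

Lemma fle_refl : reflexive fle. Proof. by move=> x; apply/fleP. Qed.
Lemma fle_anti : antisymmetric fle.
Proof.
move=> x y /andP[/fleP xy /fleP yx]; apply: fev_ext => H psi b.
by apply/eqP; rewrite eq_le xy// yx.
Qed.
Lemma fle_trans : transitive fle.
Proof.
move=> y x z /fleP xy /fleP yz; apply/fleP => H psi b.
exact: le_trans (xy _ _ b) (yz _ _ b).
Qed.

HB.instance Definition _ := Order.Le_isPOrder.Build ring_display fremlin
  fle_refl fle_anti fle_trans.

Lemma fjoin_le x y z : (fjoin x y <= z) = (x <= z) && (y <= z).
Proof.
apply/fleP/andP => [h|[/fleP xz /fleP yz] H psi b].
  split; apply/fleP => H psi b; have := h H psi b;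
    by rewrite fevE//= rjoin_le => /andP[].
by rewrite fevE//= rjoin_le xz// yz.
Qed.

Lemma fle_meet x y z : (z <= fmeet x y) = (z <= x) && (z <= y).
Proof.
apply/fleP/andP => [h|[/fleP xz /fleP yz] H psi b].
  split; apply/fleP => H psi b; have := h H psi b;
    by rewrite fevE//= le_rmeet => /andP[].
by rewrite fevE//= le_rmeet xz// yz.
Qed.

Lemma fevD (H : archiRieszType R) (psi : E -> F -> H) (x y : fremlin) :
  riesz_bimorphism psi -> fev psi (x + y) = fev psi x + fev psi y.
Proof. by move=> b; rewrite fevE. Qed.
Lemma fevZ (H : archiRieszType R) (psi : E -> F -> H) a (x : fremlin) :
  riesz_bimorphism psi -> fev psi (a *: x) = a *: fev psi x.
Proof. by move=> b; rewrite fevE. Qed.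
Lemma fev0 (H : archiRieszType R) (psi : E -> F -> H) :
  riesz_bimorphism psi -> fev psi 0 = 0.
Proof. by move=> b; rewrite fevE. Qed.

Lemma fleD2r (x y z : fremlin) : x <= y -> x + z <= y + z.
Proof.
move=> /fleP h; apply/fleP => H psi b; rewrite !fevD//.
by apply: riesz_leD2r; apply: h.
Qed.
Lemma fscale_ge0 (a : R) (x : fremlin) : 0 <= a -> 0 <= x -> 0 <= a *: x.
Proof.
move=> a0 /fleP h; apply/fleP => H psi b; rewrite fev0// fevZ//.
by apply: riesz_scale_ge0 => //; rewrite -(fev0 b); apply: h.
Qed.

HB.instance Definition _ := Lmodule_POrder_isRiesz.Build R fremlin
  fjoin_le fle_meet fleD2r fscale_ge0.

Lemma fremlin_archi (x y : fremlin) : 0 <= x -> 0 <= y ->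
  (forall n : nat, x *+ n <= y) -> x = 0.
Proof.
move=> /fleP x0 /fleP y0 xy; apply: fev_ext => H psi b; rewrite fev0//.
apply: (@riesz_archi R H _ (fev psi y)); rewrite -?(fev0 b) ?x0 ?y0// => n.
have /fleP/(_ _ _ b) := xy n.
suff -> : fev psi (x *+ n) = fev psi x *+ n by [].
by elim: n => [|n IH]; rewrite ?fev0// !mulrS fevD// IH.
Qed.
HB.instance Definition _ := Riesz_isArchimedean.Build R fremlin fremlin_archi.

Lemma fremlin_tensor_exists :
  exists (G : archiRieszType R) (tensor : E -> F -> G), fremlin_tensor tensor.
Proof.
exists fremlin, (fun x y => fpi (TGen x y)); split.
  split=> [y a x x'|x a y y'|y y0|x x0].
  - apply: fev_ext => H psi b; rewrite fevD// fevZ// !fevE//=.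
    by case: b => h *; rewrite h.
  - apply: fev_ext => H psi b; rewrite fevD// fevZ// !fevE//=.
    by case: b => _ h *; rewrite h.
  - split=> [a x x'|x x'|x x']; apply: fev_ext => H psi b;
      rewrite ?fevD// ?fevZ// !fevE//= -?/(fev _ _) ?fevE//=;
      by case: b => h _ /(_ _ y0)[h1 h2 h3] _; rewrite ?h ?h2 ?h3.
  - split=> [a x1 x'|x1 x'|x1 x']; apply: fev_ext => H psi b;
      rewrite ?fevD// ?fevZ// !fevE//= -?/(fev _ _) ?fevE//=;
      by case: b => _ h _ /(_ _ x0)[h1 h2 h3]; rewrite ?h ?h2 ?h3.
move=> H psi b; exists (fev psi); split.
  split=> [|x y]; last by rewrite fevE.
  by split=> [a x y|x y|x y]; rewrite ?fevD ?fevZ// fevE.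
move=> T [[Tl Tj Tm] Tg].
have T0 : T 0 = 0 by have := Tl (-1) 0 0; rewrite scaler0 add0r scaleN1r addNr.
have key t : T (fpi t) = teval psi t.
  elim: t => [//|//|s IHs t IHt|a t IH|s IHs t IHt|s IHs t IHt] /=.
  - have -> : fpi (TAdd s t) = 1 *: fpi s + fpi t.
      by apply: fev_ext => K phi c; rewrite fevD// fevZ// !fevE//= scale1r.
    by rewrite Tl scale1r IHs IHt.
  - have -> : fpi (TScale a t) = a *: fpi t + 0.
      by apply: fev_ext => K phi c; rewrite fevD// fevZ// fev0// !fevE//= addr0.
    by rewrite Tl T0 addr0 IH.
  - have -> : fpi (TJoin s t) = rjoin (fpi s) (fpi t).
      by apply: fev_ext => K phi c; rewrite !fevE//= -!/(fev _ _) !fevE.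
    by rewrite Tj IHs IHt.
  - have -> : fpi (TMeet s t) = rmeet (fpi s) (fpi t).
      by apply: fev_ext => K phi c; rewrite !fevE//= -!/(fev _ _) !fevE.
    by rewrite Tm IHs IHt.
apply/funext => x; have := key (repr x); rewrite /fpi reprK => ->; reflexivity.
Qed.

End FremlinExistence.
Section PiecewisePolynomials.
Variable R : realType.
Implicit Types (f g q : {nonneg R} -> R) (s : seq R) (L : seq {poly R}).

Definition polynomial_on (A : set {nonneg R}) q : Prop :=
  exists P : {poly R}, forall x, A x -> q x = P.[x%:num].

(* The nodes are t 0 < ... < t n; the values of t beyond n are irrelevant. *)
Definition piecewise_polynomial q : Prop :=
  exists (n : nat) (t : nat -> R),
    [/\ t 0%N = 0,
        forall i, (i < n)%N -> t i < t i.+1,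
        forall i, (i < n)%N ->
          polynomial_on [set x | t i <= x%:num <= t i.+1] q &
        polynomial_on [set x | t n <= x%:num] q].

Let unsplit s (A : set {nonneg R}) :=
  forall x y c, A x -> A y -> c \in s -> ~~ (x%:num < c < y%:num).

Let pieces q s L := forall A, unsplit s A ->
  exists2 P, P \in L & forall x, A x -> q x = P.[x%:num].

Let unsplit_catl s1 s2 A : unsplit (s1 ++ s2) A -> unsplit s1 A.
Proof. by move=> h x y c Ax Ay cs; apply: h => //; rewrite mem_cat cs. Qed.

Let unsplit_catr s1 s2 A : unsplit (s1 ++ s2) A -> unsplit s2 A.
Proof. by move=> h x y c Ax Ay cs; apply: h => //; rewrite mem_cat cs orbT. Qed.

Let piecesP q : piecewise_polynomial q <-> exists s L, pieces q s L.
Proof.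
split=> [[n [t [t0 tS tp tn]]]|[s [L qsL]]].
  have /choice[p pP] : forall i, exists P : {poly R}, (i <= n)%N ->
      forall x : {nonneg R}, t i <= x%:num -> (i < n)%N ==> (x%:num <= t i.+1) ->
      q x = P.[x%:num].
    move=> i; case: (ltnP i n) => [ltin|]; last first.
      rewrite leq_eqVlt => /orP[/eqP<-|ltni]; last first.
        by exists 0; rewrite leqNgt ltni.
      by have [P PP] := tn; exists P => _ x tx _; apply: PP.
    have [P PP] := tp _ ltin; exists P => _ x tx /= xt.
    by apply: PP => /=; rewrite tx xt.
  exists (map t (iota 0 n.+1)), (map p (iota 0 n.+1)) => A sA.
  pose Q i := (i <= n)%N &&
    ((i == 0%N) || `[< exists2 x : {nonneg R}, A x & t i < x%:num >]).
  have Q0 : exists i, Q i by exists 0%N.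
  have Qn i : Q i -> (i <= n)%N by case/andP.
  case: (ex_maxnP Q0 Qn) => i /andP[lein Qi] imax.
  exists (p i); first by rewrite map_f// mem_iota.
  move=> x Ax; apply: pP => //.
    case/orP: Qi => [/eqP->|/asboolP[y Ay ty]]; first by rewrite t0.
    rewrite leNgt; apply/negP => xt.
    have ti : t i \in map t (iota 0 n.+1) by rewrite map_f// mem_iota.
    by have := sA x y (t i) Ax Ay ti; rewrite xt ty.
  apply/implyP => ltin; rewrite leNgt; apply/negP => tx.
  suff /imax : Q i.+1 by rewrite ltnn.
  by rewrite /Q ltin /=; apply/asboolP; exists x.
pose u := sort <=%R (undup (0 :: [seq x <- s | 0 < x])).
have u_sorted : sorted <%R u.
  by rewrite lt_sorted_uniq_le sort_uniq undup_uniq sort_le_sorted.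
have memu x : (x \in u) = (x == 0) || (x \in s) && (0 < x).
  by rewrite mem_sort mem_undup inE mem_filter andbC.
have su : (0 < size u)%N.
  by have : 0 \in u; [rewrite memu eqxx|case: u {u_sorted memu}].
have u_ge0 x : x \in u -> 0 <= x.
  by rewrite memu => /orP[/eqP->//|/andP[_ /ltW]].
have u_mono i j : (i < size u)%N -> (j < size u)%N ->
    (nth 0 u i < nth 0 u j) = (i < j)%N.
  by move=> iu ju; apply: lt_sorted_ltn_nth.
have u0 : nth 0 u 0 = 0.
  have : 0 \in u by rewrite memu eqxx.
  move=> /(nthP 0)[[|j] ju // uj].
  have := u_mono 0%N j.+1 su ju; rewrite uj /= => uneg.
  by have := u_ge0 _ (mem_nth 0 su); rewrite leNgt uneg.
have pol i (A : set {nonneg R}) : (i < size u)%N ->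
    (forall x, A x -> nth 0 u i <= x%:num /\
      ((i.+1 < size u)%N -> x%:num <= nth 0 u i.+1)) -> polynomial_on A q.
  move=> iu Ai; have [|P _ PP] := qsL A; last by exists P.
  move=> x y c Ax Ay cs; apply/negP => /andP[xc cy].
  have : c \in u by rewrite memu cs (le_lt_trans _ xc)// orbT.
  move=> /(nthP 0)[j ju uj].
  have ltij : (i < j)%N.
    by rewrite -u_mono// uj (le_lt_trans _ xc)//; case: (Ai _ Ax).
  have iSu : (i.+1 < size u)%N by apply: leq_ltn_trans ju.
  have : (j < i.+1)%N.
    by rewrite -u_mono// uj (lt_le_trans cy)//; case: (Ai _ Ay) => _; apply.
  by rewrite ltnS leqNgt ltij.
exists (size u).-1, (nth 0 u); split=> //.
- by move=> i; rewrite ltn_predRL => iu; rewrite u_mono// (ltn_trans _ iu).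
- move=> i; rewrite ltn_predRL => iu; apply: (pol i); first exact: ltnW.
  by move=> x /= /andP[].
- apply: (pol (size u).-1); first by rewrite prednK.
  by move=> x /= ux; split=> //; rewrite prednK// ltnn.
Qed.

Let pp_linear (a : R) f g : piecewise_polynomial f -> piecewise_polynomial g ->
  piecewise_polynomial (fun x => a * f x + g x).
Proof.
move=> /piecesP[s [L fsL]] /piecesP[t [M gtM]]; apply/piecesP.
exists (s ++ t), [seq a *: P + Q | P <- L, Q <- M] => A sA.
have [P PL fP] := fsL A (unsplit_catl sA).
have [Q QM gQ] := gtM A (unsplit_catr sA).
exists (a *: P + Q); first by apply/allpairsP; exists (P, Q).
by move=> x Ax; rewrite hornerD hornerZ -fP// -gQ.
Qed.

Let pp0 : piecewise_polynomial (fun=> 0).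
Proof.
by apply/piecesP; exists [::], [:: 0] => A _; exists 0 => [|x _];
  rewrite ?inE ?horner0.
Qed.

Let pp_select f g (h : ({nonneg R} -> R)) :
  (forall x, f x <= g x -> h x = f x) -> (forall x, g x <= f x -> h x = g x) ->
  piecewise_polynomial f -> piecewise_polynomial g -> piecewise_polynomial h.
Proof.
move=> hf hg /piecesP[s [L fsL]] /piecesP[t [M gtM]]; apply/piecesP.
exists ((s ++ t) ++ flatten [seq rootsR (P - Q) | P <- L, Q <- M]), (L ++ M).
move=> A sA.
have [P PL fP] := fsL A (unsplit_catl (unsplit_catl sA)).
have [Q QM gQ] := gtM A (unsplit_catr (unsplit_catl sA)).
have [fg|/existsNP[x /not_implyP[Ax /negP]]] :=
    pselect (forall x, A x -> f x <= g x).
  exists P; first by rewrite mem_cat PL.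
  by move=> x Ax; rewrite -fP// hf// fg.
rewrite -ltNge fP// gQ// -subr_gt0 -hornerN -hornerD => x0.
exists Q; first by rewrite mem_cat QM orbT.
move=> y Ay; rewrite -gQ// hg//.
rewrite leNgt; apply/negP; rewrite fP// gQ// -subr_lt0 -hornerN -hornerD => y0.
set D := P - Q in x0 y0.
have D0 : D != 0 by apply/eqP => D0; move: x0; rewrite D0 horner0 ltxx.
have root_in z : root D z ->
    z \in (s ++ t) ++ flatten [seq rootsR (P - Q) | P <- L, Q <- M].
  move=> rz; rewrite mem_cat; apply/orP; right; apply/flattenP.
  exists (rootsR D); first by apply/allpairsP; exists (P, Q).
  by have := roots_on_rootsR D0 z; rewrite in_itv/= rz => <-.
case: (ltgtP x%:num y%:num) => [xy|yx|xy]; last first.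
- by move: x0 y0; rewrite xy => /ltW; rewrite leNgt => /negP.
- have [|z] := poly_ivtoo (ltW yx) (p := D); first by rewrite nmulr_rlt0.
  rewrite in_itv/= => yzx /root_in zs.
  by have := sA y x z Ay Ax zs; rewrite yzx.
- have [|z] := poly_ivtoo (ltW xy) (p := D); first by rewrite pmulr_rlt0.
  rewrite in_itv/= => xzy /root_in zs.
  by have := sA x y z Ax Ay zs; rewrite xzy.
Qed.

Let pp_meet f g : piecewise_polynomial f -> piecewise_polynomial g ->
  piecewise_polynomial (f `&` g)%O.
Proof.
by apply: pp_select => x fg; rewrite meetfE; [apply/meet_idPl|apply/meet_idPr].
Qed.

Let pp_join f g : piecewise_polynomial f -> piecewise_polynomial g ->
  piecewise_polynomial (f `|` g)%O.
Proof.
move=> pf pg.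
have -> : (f `|` g)%O = (fun x => -1 * (f `&` g)%O x + (1 * f x + g x)).
  apply/funext => x; rewrite joinfE meetfE mulN1r mul1r.
  by case: (leP (f x) (g x)) => _; rewrite ?addKr// addrCA addNr addr0.
by apply: pp_linear; [exact: pp_meet|exact: pp_linear].
Qed.

Definition pp_pred : pred ({nonneg R} -> R) :=
  fun q => `[< piecewise_polynomial q >].

Record PP := MkPP { pp_fun :> {nonneg R} -> R ; _ : pp_pred pp_fun }.

HB.instance Definition _ := [isSub for pp_fun].
HB.instance Definition _ := [Choice of PP by <:].

Let pp_submod_closed : submod_closed (pp_pred : {pred {nonneg R} -> R^o}).
Proof.
split=> [|a f g /asboolP pf /asboolP pg]; first exact/asboolP.
exact/asboolP/pp_linear.
Qed.

HB.instance Definition _ :=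
  GRing.SubChoice_isSubLmodule.Build R ({nonneg R} -> R^o) pp_pred PP
    pp_submod_closed.

HB.instance Definition _ :=
  Order.SubChoice_isSubPOrder.Build _ ({nonneg R} -> R) pp_pred ring_display PP.

Lemma pp_leP (f g : PP) : reflect (forall x, f x <= g x) (f <= g).
Proof. exact: (@lefP _ _ R (pp_fun f) (pp_fun g)). Qed.

Let pp_joinP (f g : PP) : pp_pred (pp_fun f `|` pp_fun g)%O.
Proof. by apply/asboolP; apply: pp_join; apply/asboolP; [case: f|case: g]. Qed.

Let pp_meetP (f g : PP) : pp_pred (pp_fun f `&` pp_fun g)%O.
Proof. by apply/asboolP; apply: pp_meet; apply/asboolP; [case: f|case: g]. Qed.

Let pp_join_le (f g h : PP) :
  (MkPP (pp_joinP f g) <= h) = (f <= h) && (g <= h).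
Proof. exact: (@leUx _ ({nonneg R} -> R)). Qed.

Let pp_le_meet (f g h : PP) :
  (h <= MkPP (pp_meetP f g)) = (h <= f) && (h <= g).
Proof. exact: (@lexI _ ({nonneg R} -> R)). Qed.

Let pp_leD2r (f g h : PP) : f <= g -> f + h <= g + h.
Proof. by move=> /pp_leP fg; apply/pp_leP => x; rewrite lerD2r. Qed.

Let pp_scale_ge0 (a : R) (f : PP) : 0 <= a -> 0 <= f -> 0 <= a *: f.
Proof.
move=> a0 /pp_leP f0; apply/pp_leP => x.
exact: (@mulr_ge0 R a (f x) a0 (f0 x)).
Qed.

HB.instance Definition _ := Lmodule_POrder_isRiesz.Build R PP
  pp_join_le pp_le_meet pp_leD2r pp_scale_ge0.

Let pp_archi (f g : PP) :
  0 <= f -> 0 <= g -> (forall n : nat, f *+ n <= g) -> f = 0.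
Proof.
move=> /pp_leP f0 /pp_leP g0 fg; apply/val_inj/funext => x /=.
apply/eqP; rewrite eq_le f0 andbT leNgt; apply/negP => fx0.
have [n /= gn] : exists n, g x < f x *+ n.
  exists (Num.bound (g x / f x)).
  rewrite -mulr_natl -ltr_pdivrMr//; apply: archi_boundP.
  by rewrite divr_ge0 ?g0 ?ltW.
have /pp_leP/(_ x) := fg n.
suff -> : (f *+ n : PP) x = f x *+ n by rewrite leNgt gn.
by elim: (n) => [//|k IH]; rewrite !mulrS -IH.
Qed.

HB.instance Definition _ := Riesz_isArchimedean.Build R PP pp_archi.

Let id_pp : pp_pred (fun x : {nonneg R} => x%:num).
Proof.
by apply/asboolP/piecesP; exists [::], [:: 'X] => A _; exists 'X => [|x _];
  rewrite ?inE ?hornerX.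
Qed.

Definition pp_id : PP := MkPP id_pp.

End PiecewisePolynomials.

(* Main.v *)
Require Import Defs.
From HB Require Import structures.
From mathcomp Require Import all_boot all_order all_algebra.
From mathcomp Require Import interval_inference polyrcf.
From mathcomp Require Import all_classical all_reals.

Set Implicit Arguments.
Unset Strict Implicit.
Unset Printing Implicit Defensive.

Import Order.TTheory GRing.Theory Num.Theory.
Local Open Scope classical_set_scope.
Local Open Scope ring_scope.

(** Let [p] be the identity function and put [z = (p^2 (x) 1) /\ (p (x) p)],
    which represents the function [min(x^2, x y)] on the quadrant.  Then
    [0 <= z <= p (x) p] and [p (x) p] lies in the tensor product of the
    principal ideal of [p] with itself, so an ideal would contain [z].

    To see that [z] is not there, restrict to the curve [y = x^3]: the map
    [f, g |-> (t |-> f(t) g(t^3))] is a Riesz bimorphism into the Riesz space of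
    all real functions on the half line ([cubic_curve_bimorphism]), hence factors
    through a Riesz homomorphism [T] on the tensor product.  A member of the
    principal ideal of [p] is affine near infinity ([principal_ideal_pp_id]), so
    [T] sends a tensor [f (x) g] of two such members to a function which near
    infinity is a combination of [1, t, t^3, t^4].  Having a polynomial germ at
    infinity without [t^2] term is preserved by linear combinations, and also by
    suprema and infima, because two polynomials are comparable near infinity
    ([no_square_subspace]).  Thus it holds for [T w] whenever [w] is in the
    Riesz subspace generated by those tensors.  But [T z] is [min(t^2, t^4)],
    that is, [t^2] for [t >= 1].

    The cube is what makes the exponents work: a line [y = c x] would let
    [x y] itself contribute a multiple of [t^2]. *)

(** * The Archimedean Riesz space of all real functions on a set *)

Section FunctionSpace.
Variables (R : realType) (X : Type).

(** A fresh name for the function type: its own pointwise order lives in another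
    display than the one that Riesz spaces require. *)
Definition fn_space : Type := X -> R.

HB.instance Definition _ := GRing.Lmodule.copy fn_space (X -> R^o).

Implicit Types f g h : fn_space.

Definition fn_le f g : bool := `[< forall x, f x <= g x >].

Lemma fn_leP f g : reflect (forall x, f x <= g x) (fn_le f g).
Proof. exact: asboolP. Qed.

Lemma fn_le_refl : reflexive fn_le.
Proof. by move=> f; apply/fn_leP. Qed.

Lemma fn_le_anti : antisymmetric fn_le.
Proof.
move=> f g /andP[/fn_leP fg /fn_leP gf]; apply/funext => x.
by apply/eqP; rewrite eq_le fg gf.
Qed.

Lemma fn_le_trans : transitive fn_le.
Proof.
by move=> g f h /fn_leP fg /fn_leP gh; apply/fn_leP => x; apply: le_trans (gh x).
Qed.

HB.instance Definition _ := Order.Le_isPOrder.Build ring_display fn_space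
  fn_le_refl fn_le_anti fn_le_trans.

Definition fn_join f g : fn_space := fun x => Num.max (f x) (g x).
Definition fn_meet f g : fn_space := fun x => Num.min (f x) (g x).

Lemma fn_join_le f g h : (fn_join f g <= h) = (f <= h) && (g <= h).
Proof.
apply/fn_leP/andP => [fgh|[/fn_leP fh /fn_leP gh] x].
  by split; apply/fn_leP => x; have := fgh x; rewrite ge_max => /andP[].
by rewrite ge_max fh gh.
Qed.

Lemma fn_le_meet f g h : (h <= fn_meet f g) = (h <= f) && (h <= g).
Proof.
apply/fn_leP/andP => [fgh|[/fn_leP fh /fn_leP gh] x].
  by split; apply/fn_leP => x; have := fgh x; rewrite le_min => /andP[].
by rewrite le_min fh gh.
Qed.

Lemma fn_leD2r f g h : f <= g -> f + h <= g + h.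
Proof. by move=> /fn_leP fg; apply/fn_leP => x; apply: lerD. Qed.

Lemma fn_scale_ge0 (a : R) f : 0 <= a -> 0 <= f -> 0 <= a *: f.
Proof. by move=> a0 /fn_leP f0; apply/fn_leP => x; apply: mulr_ge0 (f0 x). Qed.

HB.instance Definition _ := Lmodule_POrder_isRiesz.Build R fn_space
  fn_join_le fn_le_meet fn_leD2r fn_scale_ge0.

Lemma fn_mulrn f n x : (f *+ n) x = f x *+ n.
Proof. by elim: n => [//|n IH]; rewrite !mulrS -IH. Qed.

Lemma fn_archi f g : 0 <= f -> 0 <= g -> (forall n : nat, f *+ n <= g) -> f = 0.
Proof.
move=> /fn_leP f0 /fn_leP g0 fg; apply/funext => x.
apply/eqP; rewrite eq_le f0 andbT leNgt; apply/negP => fx0.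
have /fn_leP/(_ x) := fg (Num.bound (g x / f x)).
rewrite fn_mulrn leNgt -mulr_natl -ltr_pdivrMr//.
by rewrite archi_boundP// divr_ge0 ?g0 ?ltW.
Qed.

HB.instance Definition _ := Riesz_isArchimedean.Build R fn_space fn_archi.

End FunctionSpace.

(** * Polynomials and polynomial germs at infinity *)

Section PolynomialsAtInfinity.
Variable R : realFieldType.
Implicit Types P Q : {poly R}.

(** The sign of [lead_coef (Q - P)] decides which side is larger. *)
Lemma poly_eventually_le P Q :
  (exists M, forall x, M <= x -> P.[x] <= Q.[x]) \/
  (exists M, forall x, M <= x -> Q.[x] <= P.[x]).
Proof.
have pos (D : {poly R}) : 0 < lead_coef D -> exists M, forall x, M <= x -> 0 <= D.[x].
  move=> D0; have [M DM] := poly_pinfty_gt_lc D0.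
  by exists M => x Mx; apply: le_trans (DM _ Mx); apply: ltW.
case: (ltgtP (lead_coef (Q - P)) 0) => [|/pos[M DM]|/eqP].
- rewrite -oppr_gt0 -lead_coefN opprB => /pos[M DM]; right; exists M => x Mx.
  by rewrite -subr_ge0 -hornerN -hornerD DM.
- by left; exists M => x Mx; rewrite -subr_ge0 -hornerN -hornerD DM.
- by rewrite lead_coef_eq0 subr_eq0 => /eqP->; left; exists 0.
Qed.

(** Otherwise subtracting [l *: 'X] would leave the leading coefficient of [P]
    unchanged, and [P - l *: 'X] would tend to infinity in absolute value. *)
Lemma poly_linear_bound_size P (l M : R) :
  (forall x, M <= x -> `|P.[x]| <= l * x) -> (size P <= 2)%N.
Proof.
move=> Pl; rewrite leqNgt; apply/negP => sP.
wlog P0 : P Pl sP / 0 < lead_coef P => [wl|].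
  case: (ltgtP (lead_coef P) 0) => [P0|/wl|/eqP]; last 2 first.
  - exact.
  - by rewrite lead_coef_eq0 => /eqP P0; rewrite P0 size_poly0 in sP.
  - apply: (wl (- P)); rewrite ?size_polyN ?lead_coefN ?oppr_gt0// => x Mx.
    by rewrite hornerN normrN Pl.
have sl : (size (- (l *: 'X : {poly R})) < size P)%N.
  by rewrite size_polyN (leq_ltn_trans (size_scale_leq _ _))// size_polyX.
have /poly_pinfty_gt_lc[N DN] : 0 < lead_coef (P - l *: 'X).
  by rewrite lead_coefDl.
have := DN (Num.max M N); rewrite le_max lexx orbT lead_coefDl// => /(_ isT).
rewrite hornerD hornerN hornerZ hornerX leNgt => /negP; apply.
apply: le_lt_trans P0; rewrite subr_le0 (le_trans (ler_norm _))//.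
by rewrite Pl// le_max lexx.
Qed.

(** Only the exponents [0, 1, 3, 4] can occur in [(a + b X) (c + d X^3)]. *)
Lemma affine_cube_coef2 P Q : (size P <= 2)%N -> (size Q <= 2)%N ->
  (P * (Q \Po 'X^3))`_2 = 0.
Proof.
move=> sP sQ.
have E (S : {poly R}) : (size S <= 2)%N -> S = (S`_0)%:P + S`_1 *: 'X.
  move=> sS; apply/polyP => i; rewrite coefD coefC coefZ coefX.
  case: i => [|[|i]] /=; rewrite ?mulr0 ?mulr1 ?addr0 ?add0r//.
  by rewrite nth_default// (leq_trans sS).
rewrite {1}(E _ sP) {1}(E _ sQ) comp_polyD comp_polyC comp_polyZ comp_polyX.
rewrite mulrDl coefD -scalerAl coefZ coefXM coefCM /= !coefD !coefC !coefZ !coefXn /=.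
by rewrite !(mulr0, addr0).
Qed.

End PolynomialsAtInfinity.

Section PolynomialGerms.
Variable R : realType.
Implicit Types (P Q : {poly R}) (h : {nonneg R} -> R).

Definition eventually_poly h P :=
  exists M : R, forall t : {nonneg R}, M <= t%:num -> h t = P.[t%:num].

Lemma eventually_poly_lin (a : R) h h' P Q :
  eventually_poly h P -> eventually_poly h' Q ->
  eventually_poly (fun t => a * h t + h' t) (a *: P + Q).
Proof.
move=> [M hP] [N hQ]; exists (Num.max M N) => t; rewrite ge_max => /andP[Mt Nt].
by rewrite hP// hQ// hornerD hornerZ.
Qed.

Lemma eventually_poly_ordered h h' P Q :
  eventually_poly h P -> eventually_poly h' Q ->
  exists M : R, (forall t : {nonneg R}, M <= t%:num ->
      [/\ h t = P.[t%:num], h' t = Q.[t%:num] & h t <= h' t]) \/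
    (forall t : {nonneg R}, M <= t%:num ->
      [/\ h t = P.[t%:num], h' t = Q.[t%:num] & h' t <= h t]).
Proof.
move=> [M hP] [N hQ]; have [[K PQ]|[K PQ]] := poly_eventually_le P Q.
  exists (Num.max M (Num.max N K)); left => t.
  by rewrite !ge_max => /and3P[Mt Nt Kt]; rewrite hP// hQ// PQ.
exists (Num.max M (Num.max N K)); right => t.
by rewrite !ge_max => /and3P[Mt Nt Kt]; rewrite hP// hQ// PQ.
Qed.

(** The supremum has the germ of one of the two functions, not of a new
    polynomial: this is why any linear condition on the germs that holds for a
    family extends to the Riesz subspace that the family generates. *)
Lemma eventually_poly_max h h' P Q :
  eventually_poly h P -> eventually_poly h' Q ->
  eventually_poly (fun t => Num.max (h t) (h' t)) P \/
  eventually_poly (fun t => Num.max (h t) (h' t)) Q.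
Proof.
move=> hP hQ; have [M [le|le]] := eventually_poly_ordered hP hQ.
  by right; exists M => t /le[_ <- /max_idPr].
by left; exists M => t /le[<- _ /max_idPl].
Qed.

Lemma eventually_poly_min h h' P Q :
  eventually_poly h P -> eventually_poly h' Q ->
  eventually_poly (fun t => Num.min (h t) (h' t)) P \/
  eventually_poly (fun t => Num.min (h t) (h' t)) Q.
Proof.
move=> hP hQ; have [M [le|le]] := eventually_poly_ordered hP hQ.
  by left; exists M => t /le[<- _ /min_idPl].
by right; exists M => t /le[_ <- /min_idPr].
Qed.

(** A nonzero [P - Q] has no root beyond its Cauchy bound. *)
Lemma eventually_poly_unique h P Q :
  eventually_poly h P -> eventually_poly h Q -> P = Q.
Proof.
move=> [M hP] [N hQ]; apply/eqP; rewrite -subr_eq0; apply/negPn/negP => D0.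
pose t := Num.max (Num.max M N) (cauchy_bound (P - Q)).
have t0 : 0 <= t by rewrite le_max cauchy_bound_ge0 orbT.
have := cauchy_boundP D0 (x := t).
rewrite ger0_norm// hornerD hornerN.
rewrite -(hP (NngNum t0)) -?(hQ (NngNum t0)) /= ?le_max ?lexx ?orbT// subrr.
by move=> /(_ erefl); rewrite ltNge le_max lexx orbT.
Qed.

Lemma piecewise_polynomial_eventually_poly h :
  piecewise_polynomial h -> exists P, eventually_poly h P.
Proof. by move=> [n [t [_ _ _ [P hP]]]]; exists P, (t n). Qed.

Lemma polynomial_piecewise P : pp_pred (fun t : {nonneg R} => P.[t%:num]).
Proof. by apply/asboolP; exists 0%N, (fun=> 0); split=> //; exists P. Qed.

Definition pp_poly P : PP R := MkPP (polynomial_piecewise P).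

End PolynomialGerms.

(** * Positivity in Riesz spaces *)

Section RieszLemmas.
Variable R : realType.

Lemma rjoin_ler (E : rieszType R) (x y : E) : x <= y -> rjoin x y = y.
Proof.
move=> xy; apply/eqP; rewrite eq_le rjoin_le xy lexx /=.
by have := lexx (rjoin x y); rewrite rjoin_le => /andP[].
Qed.

Lemma rmeet_ler (E : rieszType R) (x y : E) : rmeet x y <= y.
Proof. by have := lexx (rmeet x y); rewrite le_rmeet => /andP[]. Qed.

Lemma riesz_abs_ge (E : rieszType R) (x : E) :
  x <= riesz_abs x /\ - x <= riesz_abs x.
Proof. by have := lexx (riesz_abs x); rewrite rjoin_le => /andP[]. Qed.

Lemma riesz_abs_ge0 (E : rieszType R) (x : E) : 0 <= x -> riesz_abs x = x.
Proof.
move=> x0; apply/eqP; rewrite eq_le (riesz_abs_ge x).1 andbT rjoin_le lexx /=.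
have := riesz_leD2r _ _ (- x) x0; rewrite subrr add0r => Nx0.
exact: le_trans Nx0 x0.
Qed.

Lemma riesz_hom0 (E F : rieszType R) (T : E -> F) : riesz_hom T -> T 0 = 0.
Proof.
by case=> Tl _ _; have := Tl (-1) 0 0; rewrite scaler0 add0r scaleN1r addNr.
Qed.

Lemma riesz_hom_ge0 (E F : rieszType R) (T : E -> F) x :
  riesz_hom T -> 0 <= x -> 0 <= T x.
Proof.
move=> hT x0; rewrite -(riesz_hom0 hT); case: hT => _ Tj _.
rewrite -(rjoin_ler x0) Tj.
by have := lexx (rjoin (T 0) (T x)); rewrite rjoin_le => /andP[].
Qed.

Lemma riesz_bimorphism_ge0 (E F G : rieszType R) (T : E -> F -> G) x y :
  riesz_bimorphism T -> 0 <= x -> 0 <= y -> 0 <= T x y.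
Proof. by case=> _ _ _ hT x0; apply: riesz_hom_ge0; apply: hT. Qed.

(** The two one-sided bounds are what can be evaluated pointwise. *)
Lemma principal_idealP (E : rieszType R) (f g : E) : 0 <= f ->
  principal_ideal f g <->
  exists2 l : R, 0 <= l & g <= l *: f /\ - g <= l *: f.
Proof.
move=> f0; split=> [[l l0]|[l l0 [gl Ngl]]].
  rewrite (riesz_abs_ge0 f0) => gl; exists l => //.
  by have [? ?] := riesz_abs_ge g; split; apply: le_trans gl.
by exists l => //; rewrite (riesz_abs_ge0 f0) rjoin_le gl.
Qed.

End RieszLemmas.

(** * Restriction of tensors to the curve y = x^3 *)

Section Curve.
Variable R : realType.
Local Notation PPR := (PP R).

Lemma pp_joinE (f g : PPR) t : rjoin f g t = Num.max (f t) (g t).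
Proof. exact: joinEtotal. Qed.

Lemma pp_meetE (f g : PPR) t : rmeet f g t = Num.min (f t) (g t).
Proof. exact: meetEtotal. Qed.

Lemma pp_linE (a : R) (f g : PPR) t : (a *: f + g) t = a * f t + g t.
Proof. by []. Qed.

Definition cubic_curve (f g : PPR) : fn_space R {nonneg R} :=
  fun t => f t * g (t%:num ^+ 3)%:nng.

(** Multiplication by a nonnegative number commutes with [max] and [min]. *)
Lemma cubic_curve_bimorphism : riesz_bimorphism cubic_curve.
Proof.
split=> [g a f f'|f a g g'|g /pp_leP g0|f /pp_leP f0].
- apply/funext => t; rewrite /cubic_curve pp_linE mulrDl -mulrA; reflexivity.
- apply/funext => t; rewrite /cubic_curve pp_linE mulrDr mulrCA; reflexivity.
- split=> [a f f'|f f'|f f']; apply/funext => t; rewrite /cubic_curve.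
  + rewrite pp_linE mulrDl -mulrA; reflexivity.
  + rewrite pp_joinE maxr_pMl; [reflexivity|exact: g0].
  + rewrite pp_meetE minr_pMl; [reflexivity|exact: g0].
- split=> [a g g'|g g'|g g']; apply/funext => t; rewrite /cubic_curve.
  + rewrite pp_linE mulrDr mulrCA; reflexivity.
  + rewrite pp_joinE maxr_pMr; [reflexivity|exact: f0].
  + rewrite pp_meetE minr_pMr; [reflexivity|exact: f0].
Qed.

Lemma pp_id_ge0 : 0 <= pp_id R.
Proof. by apply/pp_leP => t; have : 0 <= t%:num by []. Qed.

(** On its last, unbounded piece a member is a polynomial with a linear bound. *)
Lemma principal_ideal_pp_id (f : PPR) : principal_ideal (pp_id R) f ->
  exists2 P : {poly R}, (size P <= 2)%N & eventually_poly f P.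
Proof.
move=> /(principal_idealP _ pp_id_ge0)[l _ [/pp_leP fl /pp_leP Nfl]].
have [P [M fP]] : exists P, eventually_poly f P.
  by apply: piecewise_polynomial_eventually_poly; case: f {fl Nfl} => f /= /asboolP.
exists P; last by exists M.
(* The bound 0 ensures that [x] is a point of the half line. *)
apply: (@poly_linear_bound_size _ _ l (Num.max M 0)) => x.
rewrite ge_max => /andP[Mx x0].
rewrite -(fP (NngNum x0))// ler_norml lerNl.
by apply/andP; split; [exact: Nfl|exact: fl].
Qed.

Definition no_square_at_infinity (h : fn_space R {nonneg R}) :=
  exists2 P : {poly R}, P`_2 = 0 & eventually_poly h P.

Lemma no_square_subspace (G : rieszType R) (T : G -> fn_space R {nonneg R}) :
  riesz_hom T -> riesz_subspace [set z | no_square_at_infinity (T z)].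
Proof.
move=> hT; have T0 := riesz_hom0 hT; case: hT => Tl Tj Tm.
split=> [|x y /= [P P2 hP] [Q Q2 hQ]|x y /= [P P2 hP] [Q Q2 hQ]].
- split=> [/=|a x y /= [P P2 hP] [Q Q2 hQ]].
    by rewrite T0; exists 0; rewrite ?coef0//; exists 0 => t _; rewrite horner0.
  exists (a *: P + Q); first by rewrite coefD coefZ P2 Q2 mulr0 addr0.
  by rewrite Tl; apply: eventually_poly_lin.
- by rewrite Tj; have [] := eventually_poly_max hP hQ; [exists P|exists Q].
- by rewrite Tm; have [] := eventually_poly_min hP hQ; [exists P|exists Q].
Qed.

Lemma no_square_cubic_curve (f g : PPR) :
  principal_ideal (pp_id R) f -> principal_ideal (pp_id R) g ->
  no_square_at_infinity (cubic_curve f g).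
Proof.
move=> /principal_ideal_pp_id[P sP [M fP]] /principal_ideal_pp_id[Q sQ [N gQ]].
exists (P * (Q \Po 'X^3)); first exact: affine_cube_coef2.
(* From 1 on, [t <= t ^+ 3], so [t ^+ 3] is past [N] as soon as [t] is. *)
exists (Num.max 1 (Num.max M N)) => t; rewrite !ge_max => /and3P[t1 Mt Nt].
rewrite hornerM horner_comp hornerXn /cubic_curve fP// gQ//=.
by apply: le_trans Nt _; rewrite -[leLHS]expr1 ler_weXn2l.
Qed.

Lemma square_not_no_square (h : fn_space R {nonneg R}) :
  eventually_poly h 'X^2 -> ~ no_square_at_infinity h.
Proof.
move=> hX [P P2 /(eventually_poly_unique hX) XP].
by move/eqP: P2; rewrite -XP coefXn /= oner_eq0.
Qed.

End Curve.

Theorem theorem3p8 (R : realType) (G : archiRieszType R)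
    (tensor : PP R -> PP R -> G) :
  fremlin_tensor tensor ->
  ~ riesz_ideal (fremlin_subtensor tensor (principal_ideal (pp_id R))
                                          (principal_ideal (pp_id R))).
Proof.
move=> [bt univ] [_ solid].
have [T [[hT Tt] _]] := univ _ _ (@cubic_curve_bimorphism R).
pose p := pp_id R.
pose u := tensor (pp_poly 'X^2) (pp_poly 1).
pose z := rmeet u (tensor p p).
have pp0 : 0 <= tensor p p.
  by apply: riesz_bimorphism_ge0 => //; exact: pp_id_ge0.
have z0 : 0 <= z.
  rewrite le_rmeet pp0 andbT; apply: riesz_bimorphism_ge0 => //.
    by apply/pp_leP => t /=; rewrite hornerXn exprn_ge0.
  by apply/pp_leP => t /=; rewrite hornerC.
suff : no_square_at_infinity (T z).
  apply: square_not_no_square; exists 1 => t t1; case: hT => _ _ ->.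
  rewrite hornerXn !Tt.
  (* At [t] the infimum is [min (t^2, t * t^3)]. *)
  rewrite -[LHS]/(Num.min (cubic_curve _ _ t) (cubic_curve _ _ t)).
  rewrite {1}/cubic_curve /= hornerXn hornerC mulr1.
  by apply/min_idPl; rewrite /cubic_curve /= -exprS ler_weXn2l.
have pI : principal_ideal p p by exists 1; rewrite ?scale1r.
have /(solid z) : fremlin_subtensor tensor
    (principal_ideal p) (principal_ideal p) (tensor p p).
  by move=> A [_]; apply; exists p => //; exists p.
rewrite !riesz_abs_ge0// => /(_ (rmeet_ler _ _)) zI.
apply: (zI [set w | no_square_at_infinity (T w)]); split.
  exact: no_square_subspace.
by move=> _ [f fp [g gp <-]] /=; rewrite Tt; apply: no_square_cubic_curve.
Qed.
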